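(* Let $t\in\mathbb R\setminus\{0\}$ and let $\alpha\in\mathbb H_t$ with $\|\alpha\|_{op}<1$. A function $f\in\mathbf H_{2,\circledast}^t$ vanishes at $\alpha$ (i.e. $f(\alpha)=0$) if and only if it can be written as $f=b_\alpha\star g$ with $g\in\mathbf H_{2,\circledast}^t$, and, moreover, in this case $$[f,f]_{\circledast}=[g,g]_{\circledast}.$$
   Context: For $t\in\mathbb R\setminus\{0\}$, $\mathbb H_t$ is the real algebra (matrix addition and multiplication) of matrices $q_t=\begin{pmatrix}a&tb\\ \overline b&\overline a\end{pmatrix}$, $a,b\in\mathbb C$; $q_t^{\circledast}=\begin{pmatrix}\overline a&-tb\\ -\overline b&a\end{pmatrix}$; $\|q_t\|_{op}$ is the operator norm of the matrix on $\mathbb C^2$ and $\|q_t\|_E=\sqrt{|a|^2+|t||b|^2}$. $\mathbf H_2^t$ is the real vector space of power series $f(q_t)=\sum_{n=0}^\infty q_t^n\alpha_n$, $\alpha_n\in\mathbb H_t$, with $\sum_n\|\alpha_n\|_E^2<\infty$; such a series converges for $\|q_t\|_{op}<1$, and $f(\alpha)=\sum_n\alpha^n\alpha_n$ denotes its value at $q_t=\alpha$. $\mathbf H_{2,\circledast}^t$ is $\mathbf H_2^t$ endowed with the real symmetric form $[f,g]_\circledast=\sum_{n=0}^\infty{\rm Tr}\,(g_n^{\circledast}f_n)$ for $f=\sum q_t^nf_n$, $g=\sum q_t^ng_n$. The $\star$-product of power series is $\left(\sum q_t^n\alpha_n\right)\star\left(\sum q_t^n\beta_n\right)=\sum_n q_t^n\sum_{k=0}^n\alpha_{n-k}\beta_k$,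 and $S^{-\star}$ is the inverse of $S$ for $\star$. The Blaschke factor is the power series $b_\alpha(q_t)=(q_t-\alpha)\star(1-q_t\alpha^{\circledast})^{-\star}$. *)

(* Defs.v *)
From HB Require Import structures.
From mathcomp Require Import all_boot all_order all_algebra.
From mathcomp Require Import all_classical all_reals all_analysis.
From mathcomp Require Import complex ring.

Set Implicit Arguments.
Unset Strict Implicit.
Unset Printing Implicit Defensive.

Import Order.TTheory GRing.Theory Num.Theory.
Import numFieldNormedType.Exports.

Local Open Scope classical_set_scope.
Local Open Scope complex_scope.
Local Open Scope ring_scope.

(* The usual topology of C, which [complex R] only inherits through its alias
   [R[i]^o]; it also provides the one of 'M[R[i]]_2. *)
HB.instance Definition _ (R : rcfType) := NormedModule.copy R[i] R[i]^o.

Definition Hmx (R : realType) (t : R) (a b : R[i]) : 'M[R[i]]_2 :=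
  \matrix_(i < 2, j < 2)
    if i == 0 then (if j == 0 then a else t%:C * b)
    else (if j == 0 then b^* else a^*).

(* [b] is read off as the conjugate of the lower left entry, which makes sense
   for every [t]; this is membership in the image of [Hmx t], see [Ht_predP]. *)
Definition Ht_pred (R : realType) (t : R) : {pred 'M[R[i]]_2} :=
  fun q => q == Hmx t (q 0 0) (q 1 0)^*.
Arguments Ht_pred : simpl never.

Lemma Ht_predP (R : realType) (t : R) (q : 'M[R[i]]_2) :
  reflect (exists a b, q = Hmx t a b) (q \in Ht_pred t).
Proof.
apply: (iffP eqP) => [->|[a [b ->]]]; first by do 2!eexists.
by rewrite !mxE /= conjCK.
Qed.

Lemma Ht_predE (R : realType) (t : R) (q : 'M[R[i]]_2) :
  (q \in Ht_pred t) = (q 0 1 == t%:C * (q 1 0)^*) && (q 1 1 == (q 0 0)^*).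
Proof.
apply/eqP/andP => [->|[/eqP q01 /eqP q11]]; first by rewrite !mxE /= conjCK.
apply/matrixP => i j; rewrite mxE conjCK -q01 -q11.
case: i => -[|[|//]] iP; case: j => -[|[|//]] jP;
  by congr (q _ _); apply: val_inj.
Qed.

Lemma conjC_real_complex (R : realType) (x : R) : (x%:C)^* = x%:C :> R[i].
Proof. by apply/eqP; rewrite eq_complex /= oppr0 !eqxx. Qed.

Lemma Ht_pred_subring (R : realType) (t : R) : subring_closed (Ht_pred t).
Proof.
split=> [|p q|p q]; rewrite !Ht_predE.
- by rewrite !mxE /= !conjC0 conjC1 mulr0 !eqxx.
- move=> /andP[/eqP p01 /eqP p11] /andP[/eqP q01 /eqP q11].
  by rewrite !mxE p01 p11 q01 q11 !rmorphB mulrBr !eqxx.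
move=> /andP[/eqP p01 /eqP p11] /andP[/eqP q01 /eqP q11].
rewrite !mxE !big_ord_recl !big_ord0 !addr0.
rewrite (_ : lift ord0 ord0 = 1) 1?(_ : ord0 = 0); [|exact: val_inj..].
rewrite p01 p11 q01 q11 !rmorphD !rmorphM /= !conjCK !conjC_real_complex.
by apply/andP; split; apply/eqP; ring.
Qed.

HB.instance Definition _ (R : realType) (t : R) :=
  GRing.isSubringClosed.Build 'M[R[i]]_2 (Ht_pred t) (Ht_pred_subring t).

Record Ht (R : realType) (t : R) : Type :=
  MkHt { Ht_val :> 'M[R[i]]_2 ; Ht_valP : Ht_val \in Ht_pred t }.

HB.instance Definition _ (R : realType) (t : R) := [isSub for @Ht_val R t].
HB.instance Definition _ (R : realType) (t : R) := [Choice of Ht t by <:].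
HB.instance Definition _ (R : realType) (t : R) :=
  [SubChoice_isSubNzRing of Ht t by <:].

Lemma Hmx_in (R : realType) (t : R) (a b : R[i]) : Hmx t a b \in Ht_pred t.
Proof. by apply/Ht_predP; exists a, b. Qed.

Definition Hmk (R : realType) (t : R) (a b : R[i]) : Ht t := MkHt (Hmx_in t a b).

Definition Ha (R : realType) (t : R) (q : Ht t) : R[i] := Ht_val q 0 0.
Definition Hb (R : realType) (t : R) (q : Ht t) : R[i] := (Ht_val q 1 0)^*.

Lemma HmkK (R : realType) (t : R) (q : Ht t) : Hmk t (Ha q) (Hb q) = q.
Proof. by apply: val_inj; case: q => q qP; exact/esym/(eqP qP). Qed.

Lemma Ha_mk (R : realType) (t : R) (a b : R[i]) : Ha (Hmk t a b) = a.
Proof. by rewrite /Ha mxE. Qed.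

Lemma Hb_mk (R : realType) (t : R) (a b : R[i]) : Hb (Hmk t a b) = b.
Proof. by rewrite /Hb mxE /= conjCK. Qed.

Lemma Ht_scale_subproof (R : realType) (t : R) (r : R) (q : Ht t) :
  r%:C *: Ht_val q \in Ht_pred t.
Proof.
have := Ht_valP q; rewrite !Ht_predE !mxE => /andP[/eqP -> /eqP ->].
by rewrite !rmorphM /= !conjC_real_complex mulrCA !eqxx.
Qed.

Definition Ht_scale (R : realType) (t : R) (r : R) (q : Ht t) : Ht t :=
  MkHt (Ht_scale_subproof r q).

Section Algebra.
Context (R : realType) (t : R).
Implicit Types p q : Ht t.

Lemma Ht_scaleA (r s : R) q : Ht_scale r (Ht_scale s q) = Ht_scale (r * s) q.
Proof. by apply: val_inj; rewrite /= scalerA rmorphM. Qed.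

Lemma Ht_scale1 : left_id 1 (@Ht_scale R t).
Proof. by move=> q; apply: val_inj; rewrite /= scale1r. Qed.

Lemma Ht_scaleDr : right_distributive (@Ht_scale R t) +%R.
Proof. by move=> r p q; apply: val_inj; rewrite /= scalerDr. Qed.

Lemma Ht_scaleDl q : {morph (@Ht_scale R t)^~ q : r s / r + s}.
Proof. by move=> r s; apply: val_inj; rewrite /= rmorphD scalerDl. Qed.

HB.instance Definition _ := GRing.Zmodule_isLmodule.Build R (Ht t)
  Ht_scaleA Ht_scale1 Ht_scaleDr Ht_scaleDl.

Lemma Ht_scaleAl (r : R) p q : r *: (p * q) = (r *: p) * q.
Proof. by apply: val_inj; rewrite /= -scalerAl. Qed.

HB.instance Definition _ := GRing.Lmodule_isLalgebra.Build R (Ht t) Ht_scaleAl.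

Lemma Ht_scaleAr (r : R) p q : r *: (p * q) = p * (r *: q).
Proof. by apply: val_inj; rewrite /= -scalerAr. Qed.

HB.instance Definition _ := GRing.Lalgebra_isAlgebra.Build R (Ht t) Ht_scaleAr.

End Algebra.

Definition Hadj (R : realType) (t : R) (q : Ht t) : Ht t :=
  Hmk t (Ha q)^* (- Hb q).

Definition normE (R : realType) (t : R) (q : Ht t) : R :=
  Num.sqrt (Normc.normc (Ha q) ^+ 2 + `|t| * Normc.normc (Hb q) ^+ 2).

Definition l2norm (R : realType) (x : 'cV[R[i]]_2) : R :=
  Num.sqrt (\sum_(i < 2) Normc.normc (x i 0) ^+ 2).

Definition opnorm (R : realType) (A : 'M[R[i]]_2) : R :=
  sup [set l2norm (A *m x) | x in [set x : 'cV[R[i]]_2 | l2norm x <= 1]].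

(* [f : hseries t] is the formal power series sum_n q^n (f n), coefficients on
   the right. Its pointwise addition and scaling are those of functions; the
   product is [hstar], not the pointwise one. *)
Definition hseries (R : realType) (t : R) : Type := nat -> Ht t.

Section StarProduct.
Context (R : realType) (t : R).
Implicit Types f g h S T : hseries t.

Definition hC (c : Ht t) : hseries t := fun n => if n == 0%N then c else 0.

Definition hX : hseries t := fun n => if n == 1%N then 1 else 0.

Definition hstar f g : hseries t :=
  fun n => \sum_(k < n.+1) f (n - k)%N * g k.

Definition is_star_inv S T : Prop := hstar S T = hC 1 /\ hstar T S = hC 1.

(* The star-inverse, unique when it exists ([star_inv_unique]); it is 0 when
   [S] is not invertible. *)
Definition star_inv S : hseries t := xget 0 [set T | is_star_inv S T].

Definition blaschke (alpha : Ht t) : hseries t :=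
  hstar (hX - hC alpha) (star_inv (hC 1 - hstar hX (hC (Hadj alpha)))).

Lemma starE N f g n : (n < N)%N ->
  hstar f g n = ((\poly_(i < N) f i) * (\poly_(i < N) g i))`_n.
Proof.
move=> nN; rewrite coefMr; apply: eq_bigr => k _.
rewrite !coef_poly (leq_ltn_trans (leq_subr _ _) nN).
by rewrite (leq_ltn_trans _ nN) // -ltnS.
Qed.

Lemma starA f g h : hstar f (hstar g h) = hstar (hstar f g) h.
Proof.
apply/funext => n; rewrite /hstar.
transitivity (((\poly_(i < n.+1) f i) *
  ((\poly_(i < n.+1) g i) * (\poly_(i < n.+1) h i)))`_n).
  rewrite coefMr; apply: eq_bigr => k _.
  rewrite -(@starE n.+1) ?ltn_ord // coef_poly ifT //.
  by rewrite ltnS leq_subr.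
rewrite mulrA coefMr; apply: eq_bigr => k _.
rewrite -(@starE n.+1) ?ltnS ?leq_subr // coef_poly ifT //.
Qed.

Lemma star1f f : hstar (hC 1) f = f.
Proof.
apply/funext => n; rewrite /hstar big_ord_recr /= /hC subnn eqxx mul1r.
rewrite big1 ?add0r // => k _; rewrite ifF ?mul0r //.
by apply/negbTE; rewrite subn_eq0 -ltnNge.
Qed.

Lemma starf1 f : hstar f (hC 1) = f.
Proof.
apply/funext => n; rewrite /hstar big_ord_recl /= /hC subn0 mulr1.
by rewrite big1 ?addr0 // => k _; rewrite mulr0.
Qed.

Lemma star_inv_unique S T : is_star_inv S T -> star_inv S = T.
Proof.
move=> ST; apply: xget_unique => // U [SU US].
by case: ST => ST TS; rewrite -[T]starf1 -SU starA TS star1f.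
Qed.

Lemma star_inv_geometric (c : Ht t) :
  star_inv (hC 1 - hstar hX (hC c)) = fun n => c ^+ n.
Proof.
pose D : hseries t := fun n => if n == 0%N then 1 else if n == 1%N then - c else 0.
have -> : hC 1 - hstar hX (hC c) = D.
  apply/funext => n; rewrite !fctE /hstar big_ord_recl big1 => [|k _]; last first.
    by rewrite /hC /= mulr0.
  rewrite subn0 addr0 /hX /hC /D /=.
  case: n => [|[|n]] /=; rewrite ?mul0r ?mul1r ?subr0 ?sub0r //.
apply: star_inv_unique; split; apply/funext => -[|n]; rewrite /hstar.
- by rewrite big_ord1 /D /= expr0 mulr1.
- rewrite big_ord_recr big_ord_recr /= big1 => [|k _].
    by rewrite subSnn subnn /D /= mulNr -exprS mul1r add0r addNr.
  have kn := ltn_ord k.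
  by rewrite /= subSn ?(ltnW kn) // -(subnSK kn) /D /= mul0r.
- by rewrite big_ord1 /D /= expr0 mulr1.
- rewrite big_ord_recl big_ord_recl /= big1 => [|k _]; last by rewrite /D mulr0.
  by rewrite subn0 subSS subn0 /D /= addr0 mulr1 mulrN -exprSr subrr.
Qed.

End StarProduct.

(* Traces of elements of H_t are real, so taking [complex.Re] in [hform] below
   loses nothing. *)
Lemma mxtrace_Ht (R : realType) (t : R) (q : Ht t) :
  \tr (Ht_val q) = (complex.Re (\tr (Ht_val q)))%:C.
Proof.
have /andP[_ /eqP q11] := etrans (esym (Ht_predE t q)) (Ht_valP q).
rewrite /mxtrace !big_ord_recl big_ord0 addr0.
rewrite (_ : lift ord0 ord0 = 1) 1?(_ : ord0 = 0) ?q11; [|exact: val_inj..].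
by case: (Ht_val q 0 0) => x y; apply/eqP; rewrite eq_complex /= subrr !eqxx.
Qed.

Section Hardy.
Context (R : realType) (t : R).
Implicit Types f g : hseries t.

Definition H2 f : Prop := cvgn (series (fun n => normE (f n) ^+ 2)).

Definition hval f (alpha : Ht t) : 'M[R[i]]_2 :=
  limn (series (fun n => Ht_val (alpha ^+ n * f n))).

Definition hform f g : R :=
  limn (series (fun n => complex.Re (\tr (Ht_val (Hadj (g n) * f n))))).

End Hardy.

(* Main.v *)
(* Writing c for the adjugate of alpha, the factorization f = b_alpha * g means
   that some h satisfies f_n = h_(n-1) - alpha h_n and g_n = h_n - c h_(n-1).
   Then the partial sums of f(alpha) telescope to - alpha^n h_(n-1), which tends
   to 0; conversely, if f(alpha) = 0, the tails h_n = sum_k alpha^k f_(n+1+k)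
   solve the first recursion. Square-summability passes between f, g and h
   because left multiplication by alpha and by c contracts the norm of the
   first column, on which an element of H_t depends injectively. Finally
     [g_n, g_n] - [f_n, f_n]
       = (1 - det alpha) ([h_n, h_n] - [h_(n-1), h_(n-1)]),
   which telescopes, so that f and g have the same form. *)
Require Import Defs.
From mathcomp Require Import all_boot all_order all_algebra.
From mathcomp Require Import all_classical all_reals all_analysis.
From mathcomp Require Import complex ring lra.
Import Order.TTheory GRing.Theory Num.Theory.
Import numFieldNormedType.Exports.
Set Implicit Arguments.
Unset Strict Implicit.
Unset Printing Implicit Defensive.
Local Open Scope classical_set_scope.
Local Open Scope complex_scope.
Local Open Scope ring_scope.

(** * Coordinates, squared norms and determinants in [Ht t] *)

Definition sqmod (R : realType) (z : R[i]) : R :=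
  complex.Re z ^+ 2 + complex.Im z ^+ 2.

(* The squared norm of the first column of [q], hence contracted by left
   multiplications of operator norm less than 1, unlike [normE]. *)
Definition hsq (R : realType) (t : R) (q : Ht t) : R :=
  sqmod (Ha q) + sqmod (Hb q).

Definition hdet (R : realType) (t : R) (q : Ht t) : R :=
  sqmod (Ha q) - t * sqmod (Hb q).

Section SquaredNorm.
Context (R : realType) (t : R).
Implicit Types (p q : Ht t) (z : R[i]).

Lemma sqr_normc z : Normc.normc z ^+ 2 = sqmod z.
Proof.
by case: z => x y; rewrite /Normc.normc sqr_sqrtr ?addr_ge0 ?sqr_ge0.
Qed.

Lemma sqmod_ge0 z : 0 <= sqmod z.
Proof. by rewrite addr_ge0 ?sqr_ge0. Qed.

Lemma sqmodM (w z : R[i]) : sqmod (w * z) = sqmod w * sqmod z.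
Proof. by case: w => a b; case: z => c d; rewrite /sqmod /=; ring. Qed.

Lemma sqmodN z : sqmod (- z) = sqmod z.
Proof. by case: z => c d; rewrite /sqmod /=; ring. Qed.

Lemma sqmodJ z : sqmod z^* = sqmod z.
Proof. by case: z => c d; rewrite /sqmod /=; ring. Qed.

Lemma sqmod_real (x : R) : sqmod x%:C = x ^+ 2.
Proof. by rewrite /sqmod /=; ring. Qed.

Lemma sqmodE z : (sqmod z)%:C = z * z^*.
Proof.
case: z => x y; apply/eqP; rewrite eq_complex /sqmod /=.
by apply/andP; split; apply/eqP; ring.
Qed.

Lemma conjc_neq0 z : z != 0 -> z^* != 0.
Proof. by apply: contraNneq => z0; rewrite -[z]conjCK z0 conjC0. Qed.

Lemma hsq_ge0 q : 0 <= hsq q.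
Proof. by exact: addr_ge0 (sqmod_ge0 _) (sqmod_ge0 _). Qed.

Lemma Ht_ext p q : Ha p = Ha q -> Hb p = Hb q -> p = q.
Proof. by move=> a b; rewrite -[p]HmkK -[q]HmkK a b. Qed.

Lemma Ht_val01 q : Ht_val q 0 1 = t%:C * Hb q.
Proof. by have := Ht_valP q; rewrite Ht_predE => /andP[/eqP]. Qed.

Lemma Ht_val11 q : Ht_val q 1 1 = (Ha q)^*.
Proof. by have := Ht_valP q; rewrite Ht_predE => /andP[_ /eqP]. Qed.

Lemma Ht_val10 q : Ht_val q 1 0 = (Hb q)^*.
Proof. by rewrite /Hb conjCK. Qed.

Lemma big_ord2 (V : nmodType) (F : 'I_2 -> V) : \sum_i F i = F 0 + F 1.
Proof.
by rewrite !big_ord_recl big_ord0 addr0; congr (F _ + F _); exact: val_inj.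
Qed.

Lemma HaM p q : Ha (p * q) = Ha p * Ha q + t%:C * Hb p * (Hb q)^*.
Proof. by rewrite {1}/Ha mxE big_ord2 Ht_val01 Ht_val10. Qed.

Lemma HbM p q : Hb (p * q) = Ha p * Hb q + Hb p * (Ha q)^*.
Proof.
rewrite {1}/Hb mxE big_ord2 !Ht_val10 Ht_val11 rmorphD !rmorphM /= !conjCK.
by rewrite addrC.
Qed.

Lemma HaD p q : Ha (p + q) = Ha p + Ha q.
Proof. by rewrite /Ha mxE. Qed.

Lemma HbD p q : Hb (p + q) = Hb p + Hb q.
Proof. by rewrite /Hb mxE rmorphD. Qed.

Lemma HaN q : Ha (- q) = - Ha q.
Proof. by rewrite /Ha mxE. Qed.

Lemma HbN q : Hb (- q) = - Hb q.
Proof. by rewrite /Hb mxE rmorphN. Qed.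

Lemma HaZ (r : R) q : Ha (r *: q) = r%:C * Ha q.
Proof. by rewrite /Ha mxE. Qed.

Lemma HbZ (r : R) q : Hb (r *: q) = r%:C * Hb q.
Proof. by rewrite /Hb mxE rmorphM /= conjC_real_complex. Qed.

Lemma hsqN q : hsq (- q) = hsq q.
Proof. by rewrite /hsq HaN HbN !sqmodN. Qed.

Lemma hsq0 : hsq (0 : Ht t) = 0.
Proof. by rewrite /hsq /Ha /Hb !mxE conjC0 /sqmod /=; ring. Qed.

Lemma hsqZ (r : R) q : hsq (r *: q) = r ^+ 2 * hsq q.
Proof. by rewrite /hsq HaZ HbZ !sqmodM !sqmod_real [RHS]mulrDr. Qed.

Lemma hsq_eq0 q : hsq q = 0 -> q = 0.
Proof.
rewrite /hsq => /eqP; rewrite paddr_eq0 ?sqmod_ge0//.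
have sq0 z : sqmod z == 0 -> z = 0.
  rewrite paddr_eq0 ?sqr_ge0// !sqrf_eq0 => /andP[/eqP re0 /eqP im0].
  by apply/eqP; rewrite eq_complex re0 im0 !eqxx.
move=> /andP[/sq0 a0 /sq0 b0]; apply: Ht_ext; rewrite ?a0 ?b0.
  by rewrite /Ha mxE.
by rewrite /Hb mxE conjC0.
Qed.

(** Weighted Young inequality: coordinatewise the gap is [(r x - (1 - r) y)^2 / (r (1 - r))]. If
    [q = c * q'] with [hsq q <= r^2 hsq q'], the weight [r^-1] leaves the factor [r < 1] in front of
    [hsq q']. *)
Lemma hsqD p q (r : R) : 0 < r < 1 ->
  hsq (p + q) <= (1 - r)^-1 * hsq p + r^-1 * hsq q.
Proof.
move=> /andP[r0 r1].
have sq (x y : R) : (x + y) ^+ 2 <= (1 - r)^-1 * x ^+ 2 + r^-1 * y ^+ 2.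
  rewrite -subr_ge0 (_ : _ - _ = (r * x - (1 - r) * y) ^+ 2 / (r * (1 - r))).
    by rewrite divr_ge0 ?sqr_ge0// mulr_ge0 ?subr_ge0 ?ltW.
  by field; rewrite subr_eq0 gt_eqF//= gt_eqF.
rewrite /hsq HaD HbD /sqmod !raddfD /=.
have := sq (complex.Re (Ha p)) (complex.Re (Ha q)).
have := sq (complex.Im (Ha p)) (complex.Im (Ha q)).
have := sq (complex.Re (Hb p)) (complex.Re (Hb q)).
have := sq (complex.Im (Hb p)) (complex.Im (Hb q)).
lra.
Qed.

Lemma l2norm_col0 q : l2norm (col 0 (Ht_val q)) = Num.sqrt (hsq q).
Proof. by rewrite /l2norm big_ord2 !sqr_normc !mxE Ht_val10 sqmodJ. Qed.

(** [Hadj q] is the adjugate of [q], so [Hadj q * q] is the scalar matrix of the real number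
    [det q]. *)
Lemma mxtrace_adj_mul q :
  complex.Re (\tr (Ht_val (Hadj q * q))) = 2 * hdet q.
Proof.
rewrite /mxtrace big_ord2 Ht_val11 -/(Ha _) HaM /Hadj Ha_mk Hb_mk.
by rewrite /hdet /sqmod; case: (Ha q) (Hb q) => a b [c d] /=; ring.
Qed.

(** Both determinants on the left have the same cross term, because [tr (adj p * (adj c * q)) = tr
    (adj (c * p) * q)]; what remains uses [det (adj c) = det c] and multiplicativity. *)
Lemma hdet_sub_swap (c p q : Ht t) :
  hdet (p - Hadj c * q) - hdet (q - c * p) =
  (1 - hdet c) * (hdet p - hdet q).
Proof.
rewrite /hdet !HaD !HbD !HaN !HbN !HaM !HbM /Hadj !Ha_mk !Hb_mk.
rewrite /sqmod; case: (Ha p) (Hb p) (Ha q) (Hb q) (Ha c) (Hb c).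
move=> ? ? [? ?] [? ?] [? ?] [? ?] [? ?] /=; ring.
Qed.

End SquaredNorm.

(** * Operator norm and left multiplication *)

Section OperatorNorm.
Context (R : realType) (t : R).
Implicit Types (p q : Ht t) (z : R[i]).

Lemma sqmodD (w z : R[i]) : sqmod (w + z) <= 2 * sqmod w + 2 * sqmod z.
Proof.
case: w z => a b [c d]; rewrite /sqmod /=.
by have := sqr_ge0 (a - c); have := sqr_ge0 (b - d); lra.
Qed.

(** The supremum in [opnorm] dominates the set only once the set is known to be bounded. *)
Lemma opnorm_has_ubound (A : 'M[R[i]]_2) :
  has_ubound [set l2norm (A *m x) | x in [set x : 'cV[R[i]]_2 | l2norm x <= 1]].
Proof.
exists (Num.sqrt (\sum_i (2 * sqmod (A i 0) + 2 * sqmod (A i 1)))).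
move=> _ [x /= x1 <-].
have {}x1 : sqmod (x 0 0) + sqmod (x 1 0) <= 1.
  by rewrite -ler_sqrt// sqrtr1 -!sqr_normc; move: x1; rewrite /l2norm big_ord2.
rewrite /l2norm ler_wsqrtr// ler_sum// => i _.
rewrite sqr_normc mxE big_ord2 (le_trans (sqmodD _ _))// !sqmodM.
have := sqmod_ge0 (x 0 0); have := sqmod_ge0 (x 1 0).
have := sqmod_ge0 (A i 0); have := sqmod_ge0 (A i 1).
nra.
Qed.

Lemma opnorm_ge0 (A : 'M[R[i]]_2) : 0 <= opnorm A.
Proof.
apply: (le_trans (y := l2norm (A *m (0 : 'cV_2)))); first exact: sqrtr_ge0.
apply: ub_le_sup; first exact: opnorm_has_ubound.
exists 0 => //=; rewrite /l2norm big1 ?sqrtr0// => i _.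
by rewrite mxE Normc.normc0 expr0n.
Qed.

(** The first column of [p * q] is [p] applied to the first column of [q], and a nonzero [q] can be
    rescaled by a real number so that this column has length 1. *)
Lemma hsqM_opnorm (p q : Ht t) :
  hsq (p * q) <= opnorm (Ht_val p) ^+ 2 * hsq q.
Proof.
have [q0|q0] := eqVneq (hsq q) 0.
  by rewrite q0 (hsq_eq0 q0) !mulr0 hsq0.
have q_gt0 : 0 < hsq q by rewrite lt_neqAle eq_sym q0 hsq_ge0.
pose r := (Num.sqrt (hsq q))^-1.
have r2 : r ^+ 2 = (hsq q)^-1 by rewrite exprVn sqr_sqrtr ?hsq_ge0.
have : l2norm (col 0 (Ht_val (p * (r *: q)))) <= opnorm (Ht_val p).
  apply: ub_le_sup; first exact: opnorm_has_ubound.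
  exists (col 0 (Ht_val (r *: q))); last by rewrite !colE mulmxA.
  by rewrite /mkset l2norm_col0 hsqZ r2 mulVf// sqrtr1.
rewrite l2norm_col0 -scalerAr hsqZ r2 => le_op.
rewrite -ler_pdivrMr// mulrC -[leLHS]sqr_sqrtr; last first.
  by rewrite mulr_ge0 ?hsq_ge0// invr_ge0 hsq_ge0.
by rewrite lerXn2r ?nnegrE ?sqrtr_ge0 ?opnorm_ge0.
Qed.

(* [w] is the phase such that [adj p = diag (w, -1) * p * diag (1, - w^* )]. *)
Lemma hsqM_adj (p q : Ht t) : exists2 q', hsq q' = hsq q &
  hsq (Hadj p * q) = hsq (p * q').
Proof.
have [w w1 wa] : exists2 w, w * w^* = 1 & w * Ha p = (Ha p)^*.
  have [a0|a0] := eqVneq (Ha p) 0.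
    by exists 1; rewrite ?a0 ?mulr0 ?conjC0 ?conjC1 ?mulr1.
  exists ((Ha p)^* / Ha p); last by rewrite mulfVK.
  rewrite rmorphM fmorphV /= conjCK mulrC mulrA mulfVK ?divff//.
  exact: conjc_neq0.
have sw : sqmod w = 1 by apply: (@complexI R); rewrite sqmodE w1.
have wa' : w^* * (Ha p)^* = Ha p by rewrite -wa mulrCA mulrA w1 mul1r.
exists (Hmk t (Ha q) (- (w * Hb q))).
  by rewrite /hsq Ha_mk Hb_mk sqmodN sqmodM sw mul1r.
rewrite /hsq !HaM !HbM /Hadj !Ha_mk !Hb_mk; congr (_ + _).
  rewrite -[RHS]mul1r -sw -sqmodM; congr sqmod.
  rewrite -wa rmorphN rmorphM /= mulrDr mulrA; congr (_ + _).
  rewrite !mulrN mulNr; congr (- _).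
  by rewrite mulrCA [w * (_ * _)]mulrA w1 mul1r.
rewrite -[RHS]sqmodN; congr sqmod.
by rewrite mulrN opprD opprK mulrA [_ * w]mulrC wa mulNr.
Qed.

End OperatorNorm.

(** * The two star-factors of the Blaschke factor *)

Definition hshift (R : realType) (t : R) (h : hseries t) : hseries t :=
  fun n => if n is m.+1 then h m else 0.

Section StarAlgebra.
Context (R : realType) (t : R).
Implicit Types (f g h S : hseries t) (c : Ht t).

Lemma starBl f g h : hstar (f - g) h = hstar f h - hstar g h.
Proof.
apply/funext => n; rewrite /hstar !fctE -sumrB; apply: eq_bigr => k _.
by rewrite mulrBl.
Qed.

Lemma starX h : hstar (@hX R t) h = hshift h.
Proof.
apply/funext => -[|n]; rewrite /hstar /hX.
  by rewrite big_ord1 mul0r.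
rewrite 2!big_ord_recr /= subnn mul0r addr0 subSnn eqxx mul1r.
rewrite big1 ?add0r// => k _.
by rewrite subSn ?(ltnW (ltn_ord k))// -(subnSK (ltn_ord k)) mul0r.
Qed.

Lemma starC c h : hstar (hC c) h = fun n => c * h n.
Proof.
apply/funext => n; rewrite /hstar /hC big_ord_recr /= subnn eqxx.
rewrite big1 ?add0r// => k _.
by rewrite -(subnSK (ltn_ord k)) mul0r.
Qed.

Lemma star_XsubC c h n : hstar (@hX R t - hC c) h n = hshift h n - c * h n.
Proof. by rewrite starBl starX starC. Qed.

Lemma star_1subX c h n :
  hstar (hC 1 - hstar (@hX R t) (hC c)) h n = h n - c * hshift h n.
Proof.
rewrite starBl -starA star1f starX starC !fctE.
by case: n => //=; rewrite mulr0.
Qed.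

(** Without an inverse, [star_inv] would be its default value 0, whereas [star_inv_geometric] gives
    it the constant coefficient 1. *)
Lemma star_inv_1subX c : is_star_inv (hC 1 - hstar (@hX R t) (hC c))
  (star_inv (hC 1 - hstar (@hX R t) (hC c))).
Proof.
have [ex|nex] :=
  pselect (exists T, is_star_inv (hC 1 - hstar (@hX R t) (hC c)) T).
  exact: (xgetPex (P := is_star_inv _) 0 ex).
have := star_inv_geometric c; rewrite /star_inv xgetPN => [|T ST]; last first.
  by apply: nex; exists T.
by move=> /(congr1 (fun T => T 0%N))/eqP; rewrite expr0 eq_sym oner_eq0.
Qed.

(** The series [h] is the star-inverse of [1 - q (Hadj alpha)] applied to [g], and [f] is then
    [q - alpha] applied to [h]. The value 0 of [hshift h] at 0 amounts to [h_(-1) = 0]. *)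
Lemma star_blaschkeP (alpha : Ht t) f g : f = hstar (blaschke alpha) g <->
  exists h : hseries t, (forall n, f n = hshift h n - alpha * h n) /\
    (forall n, g n = h n - Hadj alpha * hshift h n).
Proof.
have [SI IS] := star_inv_1subX (Hadj alpha).
split=> [->|[h [fh gh]]].
  exists (hstar (star_inv (hC 1 - hstar (@hX R t) (hC (Hadj alpha)))) g).
  by split=> n; rewrite -?star_XsubC -?star_1subX starA ?SI ?star1f.
have -> : g = hstar (hC 1 - hstar (@hX R t) (hC (Hadj alpha))) h.
  by apply/funext => n; rewrite star_1subX.
rewrite -starA [hstar (star_inv _) _]starA IS star1f.
by apply/funext => n; rewrite star_XsubC.
Qed.

End StarAlgebra.

(** * Summability from one-step recursive inequalities *)

Section RealSeries.
Context (R : realType).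
Implicit Types (u v : R ^nat) (r M : R).

Lemma bounded_series_cvg u M : (forall n, 0 <= u n) ->
  (forall n, series u n <= M) -> cvgn (series u).
Proof.
move=> u0 uM; apply: nondecreasing_is_cvgn; first exact: nondecreasing_series.
by exists M => _ [n _ <-].
Qed.

Lemma series0 u : series u 0%N = 0.
Proof. by rewrite /series /= big_geq. Qed.

Lemma series_le_lim u : (forall n, 0 <= u n) -> cvgn (series u) ->
  forall n, series u n <= limn (series u).
Proof.
move=> u0 cu; apply: nondecreasing_cvgn_le => //.
exact: nondecreasing_series.
Qed.

Lemma term_le_lim_series u : (forall n, 0 <= u n) -> cvgn (series u) ->
  forall n, u n <= limn (series u).
Proof.
move=> u0 cu n; apply: le_trans (series_le_lim u0 cu n.+1).
by rewrite seriesSr lerDr sumr_ge0.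
Qed.

(** Summing the recursion gives [V_(n+1) <= M U_(n+1) + r V_n] for the partial sums. The bound kept
    by induction is the fixed point of [x -> M L + r x], where [L] is the sum of [u]. *)
Lemma series_forward_cvg u v r M : 0 < r < 1 -> 0 <= M ->
  (forall n, 0 <= u n) -> (forall n, 0 <= v n) ->
  v 0%N <= M * u 0%N -> (forall n, v n.+1 <= M * u n.+1 + r * v n) ->
  cvgn (series u) -> cvgn (series v).
Proof.
move=> /andP[r0 r1] M0 u0 v0 vu0 vuS cu.
have r1' : 0 < 1 - r by rewrite subr_gt0.
apply: (@bounded_series_cvg _ (M * limn (series u) / (1 - r))) => // n.
have le n0 : series v n0.+1 <= M * series u n0.+1 + r * series v n0.
  elim: n0 => [|m IH]; first by rewrite !seriesSr !series0 !add0r mulr0 addr0.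
  rewrite seriesSr [series u _]seriesSr [X in r * X]seriesSr !mulrDr.
  by have := vuS m; lra.
have L0 : 0 <= limn (series u).
  by apply: le_trans (u0 0%N) _; exact: term_le_lim_series.
elim: n => [|n IH].
  by rewrite series0 divr_ge0 ?(ltW r1')// mulr_ge0.
apply: (le_trans (le n)).
have : M * series u n.+1 <= M * limn (series u).
  by rewrite ler_wpM2l// series_le_lim.
have : r * series v n <= r * (M * limn (series u) / (1 - r)).
  by rewrite ler_wpM2l// ltW.
set x := M * limn _; have : x / (1 - r) = x + r * (x / (1 - r)).
  by field; rewrite gt_eqF.
by lra.
Qed.

(** Here each term is controlled by the next one, and [u = 0], [v n = r^-n] satisfies the recursion,
    hence the a priori bound [B]. The sum of the shifted terms is [V_n + v n - v 0 <= V_n + B], so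
    [(1 - r) V_n <= M L + r B], with [L] the sum of [u]. *)
Lemma series_backward_cvg u v r M B : 0 < r < 1 -> 0 <= M ->
  (forall n, 0 <= u n) -> (forall n, 0 <= v n) -> (forall n, v n <= B) ->
  (forall n, v n <= M * u n + r * v n.+1) ->
  cvgn (series u) -> cvgn (series v).
Proof.
move=> /andP[r0 r1] M0 u0 v0 vB vu cu.
have r1' : 0 < 1 - r by rewrite subr_gt0.
apply: (@bounded_series_cvg _ ((M * limn (series u) + r * B) / (1 - r))) => //.
move=> n.
rewrite ler_pdivlMr//.
have le : series v n <= M * series u n + r * (series v n + v n - v 0%N).
  elim: n => [|m IH].
    by rewrite !series0 mulr0 !add0r subrr mulr0.
  by rewrite !seriesSr !mulrDr; have := vu m; lra.
have : M * series u n <= M * limn (series u).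
  by rewrite ler_wpM2l// series_le_lim.
have : r * (v n - v 0%N) <= r * B.
  by rewrite ler_wpM2l ?(ltW r0)//; have := vB n; have := v0 0%N; lra.
by lra.
Qed.

End RealSeries.

(** * Square-summability for [normE] and for [hsq] *)

Section Hardy.
Context (R : realType) (t : R).
Implicit Types (f g h : hseries t).

Lemma sqr_normE (q : Ht t) : normE q ^+ 2 = sqmod (Ha q) + `|t| * sqmod (Hb q).
Proof.
by rewrite sqr_sqrtr !sqr_normc// addr_ge0 ?mulr_ge0 ?sqmod_ge0.
Qed.

(** For [t = 0] the norm [normE] would not see the second coordinate; otherwise [hsq] is at most
    [(1 + |t|^-1)] times its square. *)
Lemma H2_hsq f : t != 0 -> H2 f -> cvgn (series (fun n => hsq (f n))).
Proof.
move=> t0 hf; have nt0 : 0 < `|t| by rewrite normr_gt0.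
apply: (@series_le_cvg _ _ (fun n => (1 + `|t|^-1) * normE (f n) ^+ 2)).
- by move=> n; exact: hsq_ge0.
- by move=> n; rewrite mulr_ge0 ?sqr_ge0// addr_ge0// invr_ge0.
- move=> n; rewrite sqr_normE mulrDl mul1r [_^-1 * _]mulrDr mulKf ?gt_eqF//.
  rewrite /hsq; have := sqmod_ge0 (Ha (f n)); have := sqmod_ge0 (Hb (f n)).
  have /ltW : 0 < `|t|^-1 by rewrite invr_gt0.
  nra.
- exact: (@is_cvg_seriesZ _ _ (1 + `|t|^-1) hf).
Qed.

Lemma hsq_H2 f : cvgn (series (fun n => hsq (f n))) -> H2 f.
Proof.
move=> cf; apply: (@series_le_cvg _ _ (fun n => (1 + `|t|) * hsq (f n))).
- by move=> n; exact: sqr_ge0.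
- by move=> n; rewrite mulr_ge0 ?hsq_ge0// addr_ge0.
- move=> n; rewrite sqr_normE /hsq.
  have := sqmod_ge0 (Ha (f n)); have := sqmod_ge0 (Hb (f n)).
  by have := normr_ge0 t; nra.
- exact: (@is_cvg_seriesZ _ _ (1 + `|t|) cf).
Qed.

End Hardy.

(** * Convergence in [Ht t] *)

(** Convergence is measured by [hsq], the quantity that [alpha] contracts; [hcvg_mx] transfers it to
    the matrix topology in which [hval] is a limit. *)
Definition hcvg (R : realType) (t : R) (u : nat -> Ht t) (l : Ht t) : Prop :=
  (fun n => hsq (u n - l)) @ \oo --> (0 : R).

Section Convergence.
Context (R : realType) (t : R).
Implicit Types (p q l : Ht t) (u : nat -> Ht t).

Lemma hsqD2 p q : hsq (p + q) <= 2 * hsq p + 2 * hsq q.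
Proof.
have half : 0 < (2^-1 : R) < 1 by lra.
have := hsqD p q half; have -> : (1 - 2^-1)^-1 = 2 :> R by field.
by rewrite invrK.
Qed.

Lemma squeeze0 (v w : R ^nat) : (forall n, 0 <= v n <= w n) ->
  w @ \oo --> 0 -> v @ \oo --> 0.
Proof.
move=> vw w0; apply: (squeeze_cvgr _ (cvg_cst 0) w0).
by apply: nearW => n; rewrite vw.
Qed.

(** The factor 2 comes from [hsqD2]; any finite bound suffices as the a priori bound of
    [series_backward_cvg]. *)
Lemma hcvg_bound u l B : hcvg u l -> (forall n, hsq (u n) <= B) ->
  hsq l <= 2 * B.
Proof.
move=> ul uB.
have lim : (fun n => 2 * B + 2 * hsq (u n - l)) @ \oo --> 2 * B + 2 * 0.
  by apply: cvgD; [exact: cvg_cst|apply: cvgM => //; exact: cvg_cst].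
rewrite mulr0 addr0 in lim.
rewrite -(cvg_lim (@Rhausdorff R) lim).
apply: limr_ge; first by apply: cvgP lim.
apply: nearW => n; rewrite -[l in leLHS](subKr (u n)) (le_trans (hsqD2 _ _))//.
by rewrite hsqN lerD2r ler_pM2l.
Qed.

Lemma hcvg_unique u l l' : hcvg u l -> hcvg u l' -> l = l'.
Proof.
move=> ul ul'; apply/eqP; rewrite -subr_eq0; apply/eqP/hsq_eq0/eqP.
rewrite eq_le hsq_ge0 andbT.
have lim : (fun n => 2 * hsq (u n - l) + 2 * hsq (u n - l')) @ \oo -->
    2 * (0 : R) + 2 * 0.
  by apply: cvgD; apply: cvgM => //; exact: cvg_cst.
rewrite mulr0 addr0 in lim.
rewrite -(cvg_lim (@Rhausdorff R) lim).
apply: limr_ge; first by apply: cvgP lim.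
apply: nearW => n; have -> : l - l' = - (u n - l) + (u n - l').
  by rewrite opprB addrA subrK.
by rewrite (le_trans (hsqD2 _ _))// hsqN.
Qed.

Lemma hcvg_affine u l p q (K : R) : (forall x, hsq (q * x) <= K * hsq x) ->
  hcvg u l -> hcvg (fun n => p + q * u n) (p + q * l).
Proof.
move=> qK ul; apply: (@squeeze0 _ (fun n => K * hsq (u n - l))).
  move=> n; rewrite hsq_ge0 /= (_ : _ - _ = q * (u n - l)) ?qK//.
  by rewrite opprD addrACA subrr add0r mulrBr.
rewrite -(mulr0 K); apply: cvgM => //; exact: cvg_cst.
Qed.

Lemma hcvg_shiftS u l : hcvg u l -> hcvg (fun n => u n.+1) l.
Proof. by move=> ul; rewrite /hcvg (cvg_shiftS (fun n => hsq (u n - l))). Qed.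

Lemma sqmod_entry q i j : sqmod (Ht_val q i j) <= (1 + t ^+ 2) * hsq q.
Proof.
have t2 := sqr_ge0 t.
have a0 := sqmod_ge0 (Ha q); have b0 := sqmod_ge0 (Hb q).
have cases (P : 'I_2 -> Prop) : P 0 -> P 1 -> forall k, P k.
  by move=> P0 P1 [[|[|//]] k]; [move: P0|move: P1]; congr P; exact: val_inj.
move: i; apply: (cases); move: j; apply: (cases).
- by rewrite -/(Ha q) /hsq; nra.
- by rewrite Ht_val01 sqmodM sqmod_real /hsq; nra.
- by rewrite Ht_val10 sqmodJ /hsq; nra.
- by rewrite Ht_val11 sqmodJ /hsq; nra.
Qed.

Lemma hcvg_mx u l : hcvg u l -> (fun n => Ht_val (u n)) @ \oo --> Ht_val l.
Proof.
move=> ul; apply/cvgrPdist_lt => e e0.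
(* The radius lives in [R[i]], where being positive forces it to be real. *)
have [e' e'0 ->] : exists2 e' : R, 0 < e' & e = e'%:C.
  case: e e0 => x y; rewrite ltcE /= => /andP[/eqP -> x0].
  by exists x.
have K0 : 0 < 1 + t ^+ 2 by rewrite ltr_pwDl// sqr_ge0.
have d0 : 0 < e' ^+ 2 / (1 + t ^+ 2) by rewrite divr_gt0// exprn_gt0.
move/cvgr0_norm_lt : ul => /(_ _ d0); apply: filterS => n.
rewrite ger0_norm ?hsq_ge0// ltr_pdivlMr// mulrC => lt_e.
change (mx_norm (Ht_val l - Ht_val (u n)) < e'%:C).
(* A nonzero matrix norm is the modulus of some entry [ij]. *)
have [->|/mx_norm_neq0[ij ->]] := eqVneq (mx_norm (Ht_val l - Ht_val (u n))) 0.
  by rewrite ltcR.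
rewrite normc_def ltcR -[ltRHS]gtr0_norm// -sqrtr_sqr ltr_sqrt ?exprn_gt0//.
apply: le_lt_trans lt_e; apply: le_trans (sqmod_entry (u n - l) ij.1 ij.2).
by rewrite -[leRHS]sqmodN !mxE opprB.
Qed.

Lemma hcvg_coordinates u (a b c d : R) :
  (fun n => complex.Re (Ha (u n))) @ \oo --> a ->
  (fun n => complex.Im (Ha (u n))) @ \oo --> b ->
  (fun n => complex.Re (Hb (u n))) @ \oo --> c ->
  (fun n => complex.Im (Hb (u n))) @ \oo --> d ->
  hcvg u (Hmk t (a +i* b) (c +i* d)).
Proof.
move=> ua ub uc ud; rewrite /hcvg /hsq.
have sq (v : R ^nat) x : v @ \oo --> x -> (fun n => (v n - x) ^+ 2) @ \oo --> 0.
  move=> vx; have vx0 : (fun n => v n - x) @ \oo --> x - x.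
    by apply: cvgB => //; exact: cvg_cst.
  under eq_fun => n do rewrite expr2.
  have -> : (0 : R) = (x - x) * (x - x) by rewrite subrr mulr0.
  exact: cvgM.
have -> : (0 : R) = 0 + 0 + (0 + 0) by rewrite !addr0.
under eq_fun => n do rewrite HaD HbD HaN HbN Ha_mk Hb_mk /sqmod !raddfB /=.
by apply: cvgD; apply: cvgD; exact: sq.
Qed.

(** Completeness of [R] is used on each of the four real coordinates: they are additive with square
    at most [hsq], so their series are dominated by a geometric one. *)
Lemma hcvg_geometric u (B r : R) : 0 < r < 1 -> 0 <= B ->
  (forall n, hsq (u n) <= (B * r ^+ n) ^+ 2) ->
  exists l, hcvg (fun n => \sum_(k < n) u k) l.
Proof.
move=> /andP[r0 r1] B0 uB.
have coord (phi : Ht t -> R) : {morph phi : x y / x + y} ->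
    (forall q, phi q ^+ 2 <= hsq q) ->
    exists x : R, (fun n => phi (\sum_(k < n) u k)) @ \oo --> x.
  move=> phiD phi_le.
  have phi0 : phi 0 = 0 by apply: (addrI (phi 0)); rewrite -phiD !addr0.
  suff /cvg_ex[x xl] : cvgn (series (phi \o u)).
    exists x; under eq_fun => n do rewrite (big_morph phi phiD phi0).
    by move: xl; rewrite seriesEord.
  apply: normed_cvg; apply: (@series_le_cvg _ _ (geometric B r)) => //.
  - by move=> n; exact: normr_ge0.
  - by move=> n; rewrite /geometric /= mulr_ge0 ?exprn_ge0// ltW.
  - move=> n; rewrite /geometric /= -(@ler_pXn2r _ 2)// ?nnegrE//.
      by rewrite real_normK ?num_real// (le_trans (phi_le _)).
    by rewrite mulr_ge0 ?exprn_ge0// ltW.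
  - by apply: is_cvg_geometric_series; rewrite gtr0_norm.
have sq_le (x y z w : R) : x ^+ 2 <= x ^+ 2 + y ^+ 2 + (z ^+ 2 + w ^+ 2).
  by rewrite -addrA lerDl !addr_ge0 ?sqr_ge0.
have [|q|a ua] := coord (fun q => complex.Re (Ha q)).
- by move=> p q; rewrite HaD raddfD.
- exact: sq_le.
have [|q|b ub] := coord (fun q => complex.Im (Ha q)).
- by move=> p q; rewrite HaD raddfD.
- by rewrite /hsq /sqmod [X in _ <= X + _]addrC; exact: sq_le.
have [|q|c uc] := coord (fun q => complex.Re (Hb q)).
- by move=> p q; rewrite HbD raddfD.
- by rewrite /hsq addrC; exact: sq_le.
have [|q|d ud] := coord (fun q => complex.Im (Hb q)).
- by move=> p q; rewrite HbD raddfD.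
- by rewrite /hsq /sqmod addrC [X in _ <= X + _]addrC; exact: sq_le.
by eexists; exact: hcvg_coordinates ua ub uc ud.
Qed.

End Convergence.

(** * Consequences of the contraction by [alpha] *)

Section Contraction.
Context (R : realType) (t : R) (alpha : Ht t) (r : R).
Hypothesis r01 : 0 < r < 1.
Hypothesis alpha_le : forall q, hsq (alpha * q) <= r ^+ 2 * hsq q.
Implicit Types (f g h : hseries t) (p q : Ht t).

(** A 2 by 2 matrix and its adjugate have the same singular values, so the adjugate contracts as
    much as [alpha]. *)
Lemma hsq_mul_adj q : hsq (Hadj alpha * q) <= r ^+ 2 * hsq q.
Proof. by have [q' <- ->] := hsqM_adj alpha q. Qed.

Lemma hsq_expM n q : hsq (alpha ^+ n * q) <= (r ^+ n) ^+ 2 * hsq q.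
Proof.
elim: n => [|n IH]; first by rewrite expr0 mul1r expr1n mul1r.
rewrite exprS -mulrA (le_trans (alpha_le _))//.
rewrite [r ^+ n.+1]exprS exprMn -[leRHS]mulrA.
by rewrite ler_wpM2l ?sqr_ge0.
Qed.

Lemma hsqD_contraction c p q : (forall x, hsq (c * x) <= r ^+ 2 * hsq x) ->
  hsq (p + c * q) <= (1 - r)^-1 * hsq p + r * hsq q.
Proof.
move=> c_le; have /andP[r0 _] := r01.
rewrite (le_trans (hsqD _ _ r01))// lerD2l.
by rewrite ler_pdivrMl// mulrA -expr2.
Qed.

Lemma invB_ge0 : 0 <= (1 - r)^-1.
Proof. by have /andP[_ r1] := r01; rewrite invr_ge0 subr_ge0 ltW. Qed.

Lemma cvg_star_inv g h : (forall n, g n = h n - Hadj alpha * hshift h n) ->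
  cvgn (series (fun n => hsq (g n))) -> cvgn (series (fun n => hsq (h n))).
Proof.
move=> gh; apply: (series_forward_cvg r01 invB_ge0) => [n|n||n].
- exact: hsq_ge0.
- exact: hsq_ge0.
(* At index 0 the recursion reads [g 0 = h 0], and [(1 - r)^-1] is at least 1. *)
- rewrite gh /= mulr0 subr0 ler_peMl ?hsq_ge0// invf_ge1.
    by have /andP[r0 _] := r01; lra.
  by have /andP[_ r1] := r01; lra.
- have -> : h n.+1 = g n.+1 + Hadj alpha * h n by rewrite gh subrK.
  by apply: hsqD_contraction; exact: hsq_mul_adj.
Qed.

Lemma cvg_star_1subX g h : (forall n, g n = h n - Hadj alpha * hshift h n) ->
  cvgn (series (fun n => hsq (h n))) -> cvgn (series (fun n => hsq (g n))).
Proof.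
move=> gh ch; have /andP[r0 r1] := r01.
have hsq_h_ge0 n : 0 <= hsq (h n) by exact: hsq_ge0.
pose L := limn (series (fun n => hsq (h n))).
apply: (@bounded_series_cvg _ _ ((1 - r)^-1 * L + r * L)) => [n|n].
  exact: hsq_ge0.
have Lh k : series (fun n => hsq (hshift h n)) k <= L.
  apply: le_trans (series_le_lim hsq_h_ge0 ch k).
  case: k => [|k]; first by rewrite !series0.
  have -> : series (fun n => hsq (hshift h n)) k.+1 =
      series (fun n => hsq (h n)) k.
    by rewrite !seriesEord /= big_ord_recl /= hsq0 add0r.
  by rewrite seriesSr lerDl.
have gn k : hsq (g k) <= (1 - r)^-1 * hsq (h k) + r * hsq (hshift h k).
  (* The minus sign is moved onto [hshift h k], since [hsqD_contraction] bounds a sum. *)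
  rewrite gh -mulrN -[hsq (hshift h k)]hsqN.
  by apply: hsqD_contraction; exact: hsq_mul_adj.
apply: (@le_trans _ _ ((1 - r)^-1 * series (fun k => hsq (h k)) n +
    r * series (fun k => hsq (hshift h k)) n)).
  by rewrite /series /= !mulr_sumr -big_split ler_sum.
by rewrite lerD// ler_wpM2l ?invB_ge0 ?(ltW r0)// series_le_lim.
Qed.

(** For [n = 0] these are the partial sums of [f] at [alpha]; letting the start [n] vary gives the
    recursion [tail_sumS]. *)
Definition tail_sum f n m : Ht t := \sum_(k < m) alpha ^+ k * f (n + k)%N.

Lemma tail_sumS f n m :
  tail_sum f n m.+1 = f n + alpha * tail_sum f n.+1 m.
Proof.
rewrite /tail_sum big_ord_recl expr0 mul1r addn0 mulr_sumr; congr (_ + _).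
by apply: eq_bigr => k _; rewrite mulrA -exprS addSnnS.
Qed.

Lemma exists_tail f : cvgn (series (fun n => hsq (f n))) ->
  exists s : hseries t, [/\ hcvg (tail_sum f 0) (s 0%N),
    forall n, s n = f n + alpha * s n.+1 &
    cvgn (series (fun n => hsq (s n)))].
Proof.
move=> cf; have /andP[r0 r1] := r01; have r1' : 0 < 1 - r by rewrite subr_gt0.
have hsq_f_ge0 n : 0 <= hsq (f n) by exact: hsq_ge0.
pose L := limn (series (fun n => hsq (f n))).
have fL n : hsq (f n) <= L by exact: term_le_lim_series.
have L0 : 0 <= L by exact: le_trans (hsq_f_ge0 0%N) (fL 0%N).
have /choice[s fs] : forall n, exists l, hcvg (tail_sum f n) l.
  move=> n.
  apply: (@hcvg_geometric _ _ (fun k => alpha ^+ k * f (n + k)%N) _ _ r01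
    (sqrtr_ge0 L)) => k.
  rewrite exprMn sqr_sqrtr// mulrC (le_trans (hsq_expM _ _))//.
  by rewrite ler_wpM2l ?sqr_ge0.
have sE n : s n = f n + alpha * s n.+1.
  (* Both sides are limits of [tail_sum f n m.+1] as [m] grows. *)
  have := hcvg_affine (f n) alpha_le (fs n.+1).
  under [X in hcvg X]eq_fun => m do rewrite -tail_sumS.
  by apply: hcvg_unique; exact: hcvg_shiftS.
exists s; split=> //.
(* [B] is the fixed point of [x -> (1 - r)^-1 L + r x], the map by which [tail_sumS] propagates
   bounds. *)
pose B := L / (1 - r) ^+ 2.
have tail_le m n : hsq (tail_sum f n m) <= B.
  elim: m n => [|m IH] n.
    by rewrite /tail_sum big_ord0 hsq0 divr_ge0 ?sqr_ge0.
  rewrite tail_sumS (le_trans (hsqD_contraction _ _ alpha_le))//.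
  have -> : B = (1 - r)^-1 * L + r * B by rewrite /B; field; rewrite gt_eqF.
  by rewrite lerD// ler_wpM2l ?invB_ge0 ?(ltW r0).
apply: (@series_backward_cvg _ _ _ _ _ (2 * B) r01 invB_ge0 hsq_f_ge0) => //.
- by move=> n; exact: hsq_ge0.
- by move=> n; exact: hcvg_bound (fs n) _.
- by move=> n; rewrite {1}sE; exact: hsqD_contraction.
Qed.

Lemma hval_tail f l : hcvg (tail_sum f 0) l -> hval f alpha = Ht_val l.
Proof.
move=> /hcvg_mx fl; apply: cvg_lim; first exact: norm_hausdorff.
rewrite (_ : series _ = fun n => Ht_val (tail_sum f 0 n))//.
apply/funext => n; rewrite seriesEord /tail_sum.
by rewrite (big_morph (@Ht_val R t) (id1 := 0) (op1 := +%R)).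
Qed.

Lemma hval_star_XsubC f h : (forall n, f n = hshift h n - alpha * h n) ->
  cvgn (series (fun n => hsq (h n))) -> hval f alpha = 0.
Proof.
move=> fh ch; have /andP[r0 r1] := r01.
have sumE n : tail_sum f 0 n = - (alpha ^+ n * hshift h n).
  rewrite /tail_sum; elim: n => [|n IH]; first by rewrite big_ord0 mulr0 oppr0.
  by rewrite big_ord_recr IH /= add0n fh mulrBr addKr mulrA -exprSr.
(* After a shift by one, [hshift h n.+1] is [h n], whose [hsq] tends to 0 as the term of a
   convergent series; the powers of [alpha] only need to stay bounded. *)
rewrite (@hval_tail f 0)// /hcvg -(cvg_shiftS (fun n => hsq _)).
apply: (@squeeze0 _ _ (fun n => hsq (h n))); last exact: cvg_series_cvg_0.
move=> n /=; rewrite hsq_ge0 subr0 sumE hsqN (le_trans (hsq_expM _ _))//.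
by rewrite ler_piMl ?hsq_ge0// !exprn_ile1 ?exprn_ge0// ltW.
Qed.

Lemma hdet_le q : `|hdet q| <= (1 + `|t|) * hsq q.
Proof.
have a0 := sqmod_ge0 (Ha q); have b0 := sqmod_ge0 (Hb q).
rewrite (le_trans (ler_normB _ _))// normrM (ger0_norm a0) (ger0_norm b0) /hsq.
by have := normr_ge0 t; nra.
Qed.

Lemma hformE f : hform f f = limn (series (fun n => 2 * hdet (f n))).
Proof. by rewrite /hform; under eq_fun => n do rewrite mxtrace_adj_mul. Qed.

Lemma hform_blaschke f g h :
  (forall n, f n = hshift h n - alpha * h n) ->
  (forall n, g n = h n - Hadj alpha * hshift h n) ->
  cvgn (series (fun n => hsq (f n))) -> cvgn (series (fun n => hsq (h n))) ->
  hform f f = hform g g.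
Proof.
move=> fh gh cf ch; rewrite !hformE; apply/esym.
have K0 : 0 <= 2 * (1 + `|t|) by rewrite mulr_ge0// addr_ge0.
(* The determinant may take both signs, so convergence is obtained absolutely, by domination by
   [hsq]. *)
have cdet : cvgn (series (fun n => 2 * hdet (f n))).
  apply: normed_cvg.
  apply: (@series_le_cvg _ _ (fun n => 2 * (1 + `|t|) * hsq (f n))) => [n|n|n|].
  - exact: normr_ge0.
  - by rewrite mulr_ge0 ?hsq_ge0.
  - by rewrite /= normrM ger0_norm// -mulrA ler_wpM2l ?hdet_le.
  - exact: (@is_cvg_seriesZ _ _ _ cf).
(* By telescoping, the partial sums differ by one boundary term in [h_(n-1)], which is 0 for [n = 0]
   and tends to 0. *)
have gE n : series (fun n => 2 * hdet (g n)) n =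
    series (fun n => 2 * hdet (f n)) n
    + 2 * (1 - hdet alpha) * hdet (hshift h n).
  elim: n => [|n IH].
    by rewrite !series0 /hdet /Ha /Hb !mxE conjC0 /sqmod /=; ring.
  rewrite !seriesSr IH /= gh fh.
  have := hdet_sub_swap alpha (h n) (hshift h n).
  set x := hdet (_ - _); set y := hdet (_ - _) => xy.
  have -> : x = y + (1 - hdet alpha) * (hdet (h n) - hdet (hshift h n)).
    by rewrite -xy; ring.
  by ring.
apply: cvg_lim => //; rewrite (funext gE).
rewrite -[X in _ --> X]addr0; apply: cvgD => //.
rewrite -(mulr0 (2 * (1 - hdet alpha))); apply: cvgM; first exact: cvg_cst.
rewrite -(cvg_shiftS (fun n => hdet _)) /=; apply/norm_cvg0P.
apply: (@squeeze0 _ _ (fun n => (1 + `|t|) * hsq (h n))).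
  by move=> n /=; rewrite normr_ge0 hdet_le.
rewrite -(mulr0 (1 + `|t|)); apply: cvgM; first exact: cvg_cst.
exact: cvg_series_cvg_0.
Qed.

End Contraction.

(** * Division by the Blaschke factor *)

Theorem theorem4p11 (R : realType) (t : R) (ht : t != 0)
    (alpha : Ht t) (halpha : opnorm (Ht_val alpha) < 1)
    (f : hseries t) (hf : H2 f) :
  (hval f alpha = 0 <->
     exists2 g : hseries t, H2 g & f = hstar (blaschke alpha) g) /\
  (forall g : hseries t, H2 g -> f = hstar (blaschke alpha) g ->
     hform f f = hform g g).
Proof.
have a0 := opnorm_ge0 (Ht_val alpha).
(* The midpoint between the operator norm and 1 is positive even for [alpha = 0], as the weight
   [r^-1] in [hsqD] requires. *)
pose r := (1 + opnorm (Ht_val alpha)) / 2.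
have r01 : 0 < r < 1 by rewrite /r; apply/andP; split; lra.
have alpha_le q : hsq (alpha * q) <= r ^+ 2 * hsq q.
  rewrite (le_trans (hsqM_opnorm _ _))// ler_wpM2r ?hsq_ge0//.
  by rewrite lerXn2r ?nnegrE /r//; lra.
have cf := H2_hsq ht hf.
split; last first.
  move=> g hg /star_blaschkeP[h [fh gh]].
  apply: (hform_blaschke fh gh cf).
  exact: (cvg_star_inv r01 alpha_le gh (H2_hsq ht hg)).
split=> [f0|[g hg /star_blaschkeP[h [fh gh]]]]; last first.
  apply: (hval_star_XsubC r01 alpha_le fh).
  exact: (cvg_star_inv r01 alpha_le gh (H2_hsq ht hg)).
have [s [fs sE cs]] := exists_tail r01 alpha_le cf.
have s0 : s 0%N = 0 by apply: val_inj; rewrite /= -(hval_tail fs).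
(* The recursion [f_n = s_n - alpha s_(n+1)] becomes [f_n = h_(n-1) - alpha h_n]; at [n = 0] this is
   where [s_0 = f(alpha) = 0] is used, to match [h_(-1) = 0]. *)
pose h : hseries t := fun n => s n.+1.
have ch : cvgn (series (fun n => hsq (h n))).
  apply: (@bounded_series_cvg _ _ (limn (series (fun n => hsq (s n))))) => n.
    exact: hsq_ge0.
  have hsq_s_ge0 k : 0 <= hsq (s k) by exact: hsq_ge0.
  apply: le_trans (series_le_lim hsq_s_ge0 cs n.+1).
  by rewrite !seriesEord /= big_ord_recl s0 hsq0 add0r.
exists (fun n => h n - Hadj alpha * hshift h n).
  by apply: hsq_H2; exact: (cvg_star_1subX r01 alpha_le (h := h)).
apply/star_blaschkeP; exists h; split=> // -[|n].
  by apply/eqP; rewrite sub0r -addr_eq0 -sE s0.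
by rewrite /= /h [s n.+1]sE addrK.
Qed.
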